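(* Let $(X,d)$ be a $Q$-ary distance-regular space of dimension $N\ge 2$ over $\mathbb{F}_Q$ with weight $\omega$. Let $0\le k\le N$ be an integer, and let $\mathcal{F}$ denote the family of $k$-dimensional $\mathbb{F}_Q$-linear codes in $X$. The average weight distribution of $\mathcal{F}$ is $$\overline{W_0}(\mathcal{F})=1\qquad\text{and}\qquad \overline{W_i}(\mathcal{F})=\frac{Q^k-1}{Q^N-1}\,W_i(X)\quad\text{for } 1\le i\le|\omega|.$$
   Context: Let $Q$ be a prime power, $X$ a finite-dimensional $\mathbb{F}_Q$-vector space and $d:X\times X\to\mathbb{N}$ an integer-valued distance function. $(X,d)$ is a $Q$-ary distance-regular space if: (1) $d(\alpha x,\alpha y)=d(x,y)$ for all $x,y\in X$, $\alpha\in\mathbb{F}_Q\setminus\{0\}$; (2) $d(x,y)=d(0,x-y)$ for all $x,y\in X$; (3) for all $x,y\in X$ and $j,k\in\mathbb{N}$, $|\{z\in X\mid d(z,x)=j,\ d(z,y)=k\}|$ depends only on $d(x,y)$ (and $j,k$); (4) with $\omega(x):=d(x,0)$ the weight, $|\omega|:=\max\{\omega(x)\mid x\in X\}=|\omega(X)|-1$, i.e. every integer in $\{0,\dots,|\omega|\}$ is the weight of some vector. A linear code in $X$ is an $\mathbb{F}_Q$-subspace of $X$. For a code $\mathcal{C}\subseteq X$, $W_i(\mathcal{C}):=|\{x\in\mathcal{C}\mid\omega(x)=i\}|$. For a non-empty family $\mathcal{F}$ of codes, $\overline{W_i}(\mathcal{F}):=|\mathcal{F}|^{-1}\sum_{\mathcal{C}\in\mathcal{F}}W_i(\mathcal{C})$.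 *)

(* Defs.v *)
From HB Require Import structures.
From mathcomp Require Import all_boot all_order all_algebra all_field.

Set Implicit Arguments.
Unset Strict Implicit.
Unset Printing Implicit Defensive.

Import GRing.Theory.
Local Open Scope ring_scope.

HB.instance Definition _ (F : finFieldType) (V : vectType F) :=
  isCountable.Build {vspace V}
    (pcan_pickleK (can_pcan (@VectorInternalTheory.vs2mxK F V))).
HB.instance Definition _ (F : finFieldType) (V : vectType F) :=
  isFinite.Build {vspace V}
    (pcan_enumP (can_pcan (@VectorInternalTheory.vs2mxK F V))).

(* [V : vectType F] over a finite field has no canonical finType structure;
   [finvect_type V] is [V] itself, equipped with both structures. *)

Definition weight (F : finFieldType) (V : vectType F)
    (d : finvect_type V -> finvect_type V -> nat) (x : finvect_type V) : nat :=
  d x 0.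

Definition max_weight (F : finFieldType) (V : vectType F)
    (d : finvect_type V -> finvect_type V -> nat) : nat :=
  \max_(x : finvect_type V) weight d x.

Definition is_distance (T : Type) (d : T -> T -> nat) : Prop :=
  [/\ forall x y, d x y = 0%N <-> x = y,
      forall x y, d x y = d y x &
      forall x y z, (d x z <= d x y + d y z)%N].

Record distance_regular (F : finFieldType) (V : vectType F)
    (d : finvect_type V -> finvect_type V -> nat) : Prop := DistanceRegular {
  dr_distance : is_distance d;
  dr_scale : forall (a : F) (x y : finvect_type V),
    a != 0 -> d (a *: x) (a *: y) = d x y;
  dr_translate : forall x y : finvect_type V, d x y = d 0 (x - y);
  dr_intersection : forall x y x' y' : finvect_type V, d x y = d x' y' ->
    forall j k : nat,
      #|[set z | (d z x == j) && (d z y == k)]|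
      = #|[set z | (d z x' == j) && (d z y' == k)]|;
  (* [undup (codom _)] lists the image of the weight without repetition *)
  dr_weights : max_weight d = (size (undup (codom (weight d)))).-1
}.

Definition weight_enum (F : finFieldType) (V : vectType F)
    (d : finvect_type V -> finvect_type V -> nat) (i : nat)
    (C : {vspace finvect_type V}) : nat :=
  #|[set x in C | weight d x == i]|.

(* Only meaningful for a non-empty family. *)
Definition avg_weight_enum (F : finFieldType) (V : vectType F)
    (d : finvect_type V -> finvect_type V -> nat) (i : nat)
    (Fam : {set {vspace finvect_type V}}) : rat :=
  #|Fam|%:R^-1 * \sum_(C in Fam) (weight_enum d i C)%:R.

Definition codes_of_dim (F : finFieldType) (V : vectType F) (k : nat) :
    {set {vspace finvect_type V}} :=
  [set C | \dim C == k].

(* Main.v *)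
(** The general linear group acts transitively on the nonzero vectors, so every
    nonzero [x] lies in the same number [m] of [k]-dimensional codes.  Counting
    the pairs [(x, C)] with [x] a vector of [C] subject to a condition [P x] that
    excludes [0] gives [m] times the number of vectors satisfying [P].  Taking
    [P] to be [x != 0] determines [m]; taking [P] to be [weight d x == i] gives
    the result. *)
Require Import Defs.
From HB Require Import structures.
From mathcomp Require Import all_boot all_order all_algebra all_field.
Import GRing.Theory Num.Theory VectorInternalTheory.
Local Open Scope ring_scope.

(** In coordinates [x] and [y] are row vectors of rank 1. The matrix [pinvmx (v2r x) *m v2r y] sends
    one to the other but is singular in general; as it preserves the rank of [v2r x], some
    invertible matrix agrees with it there. *)
Lemma exists_lker0_map (F : fieldType) (V : vectType F) (x y : V) :
  x != 0 -> y != 0 -> exists2 f : 'End(V), lker f == 0%VS & f x = y.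
Proof.
have v2r_free (z : V) : z != 0 -> row_free (v2r z).
  by rewrite -(inj_eq (@v2r_inj F V)) linear0 /row_free rank_rV => ->.
move=> /v2r_free x_free /v2r_free y_free.
have xAy : v2r x *m (pinvmx (v2r x) *m v2r y) = v2r y.
  by rewrite mulmxA mulmxVp // mul1mx.
have [|g g_unit xg] := @complete_unitmx F _ _ (v2r x) (pinvmx (v2r x) *m v2r y).
  by rewrite xAy (eqP x_free) (eqP y_free).
exists (linfun (r2v \o mulmxr g \o v2r)); last first.
  by rewrite lfunE /= -xg xAy v2rK.
apply/lker0P => u v; rewrite !lfunE /= => /r2v_inj.
by rewrite -row_free_unit in g_unit; move=> /(row_free_inj g_unit) /v2r_inj.
Qed.

Lemma exists_vspace_dim (F : fieldType) (V : vectType F) (k : nat) :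
  (k <= \dim {:V})%N -> exists U : {vspace V}, \dim U = k.
Proof.
move=> k_le; pose b := vbasis {:V}; exists <<take k b>>%VS.
have : free (take k b ++ drop k b).
  by rewrite cat_take_drop (basis_free (vbasisP _)).
by move=> /catl_free /eqP ->; rewrite size_takel // size_tuple.
Qed.

Section Codes.

Variables (F : finFieldType) (X : vectType F) (k : nat).
Notation codes := (codes_of_dim X k).

Definition codes_through (x : finvect_type X) := [set C in codes | x \in C].

(** An injective endomorphism taking [x] to [y] preserves dimension, and taking images under it is
    injective on subspaces. *)
Lemma leq_card_codes_through (x y : finvect_type X) :
  x != 0 -> y != 0 -> (#|codes_through x| <= #|codes_through y|)%N.
Proof.
move=> x0 y0; have [f f_inj fx] := exists_lker0_map _ _ _ _ x0 y0.
have img_inj : injective (fun C : {vspace finvect_type X} => (f @: C)%VS).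
  by move=> C D /eqP; rewrite eq_limg_ker0 // => /eqP.
rewrite -(card_imset _ img_inj); apply/subset_leq_card/subsetP => D.
case/imsetP => C; rewrite !inE => /andP[/eqP dimC Cx] ->.
by rewrite limg_dim_eq ?dimC ?eqxx -?fx ?memv_img // (eqP f_inj) capv0.
Qed.

Lemma card_codes_through (x y : finvect_type X) :
  x != 0 -> y != 0 -> #|codes_through x| = #|codes_through y|.
Proof.
by move=> x0 y0; apply/eqP; rewrite eqn_leq !leq_card_codes_through.
Qed.

(** Double counting: after the sums are exchanged, each [y] with [P y] is nonzero because [P 0]
    fails, so it lies in as many codes as the reference vector [x]. *)
Lemma sum_codes_card (P : pred (finvect_type X)) (x : finvect_type X) :
  x != 0 -> ~~ P 0 ->
  (\sum_(C in codes) #|[set y in C | P y]|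
   = #|[set y | P y]| * #|codes_through x|)%N.
Proof.
move=> x0 P0; rewrite -sum_nat_const.
under eq_bigr do rewrite -sum1dep_card.
rewrite (exchange_big_dep P) /=; last by move=> C y _ /andP[].
rewrite big_set; apply: eq_bigr => y Py.
have y0 : y != 0 by apply: contraNneq P0 => <-.
rewrite (card_codes_through x y) // -sum1_card.
by apply: eq_bigl => C; rewrite !inE Py andbT.
Qed.

Lemma card_vspace_neq0 (C : {vspace finvect_type X}) :
  #|[set x in C | x != 0]| = (#|F| ^ \dim C - 1)%N.
Proof.
rewrite -card_vspace (cardD1 0 (mem C)) mem0v add1n subn1 /=.
by rewrite cardsE; apply: eq_card => x; rewrite !inE andbC.
Qed.

(** Kept as a product in [nat], this determines [#|codes_through x|] without any division. *)
Lemma card_codes_mul (x : finvect_type X) : x != 0 ->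
  (#|codes| * (#|F| ^ k - 1)
   = (#|F| ^ \dim {: finvect_type X} - 1) * #|codes_through x|)%N.
Proof.
move=> x0; rewrite -card_vspace_neq0.
have -> : [set y in {: finvect_type X}%VS | y != 0] = [set y | y != 0].
  by apply/setP => y; rewrite !inE memvf.
rewrite -sum_codes_card ?eqxx // -sum_nat_const; apply: eq_bigr => C.
by rewrite inE card_vspace_neq0 => /eqP ->.
Qed.

Lemma card_codes_gt0 : (k <= \dim {: finvect_type X})%N -> (0 < #|codes|)%N.
Proof.
move=> /exists_vspace_dim[C dimC].
by apply/card_gt0P; exists C; rewrite inE dimC.
Qed.

End Codes.

Theorem theorem9p2 (Q : nat) (F : finFieldType) (cardF : #|F| = Q)
  (X : vectType F) (d : finvect_type X -> finvect_type X -> nat)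
  (Xd : distance_regular d)
  (N : nat) (dimX : \dim {: finvect_type X} = N) (N_ge2 : (2 <= N)%N)
  (k : nat) (k_le_N : (k <= N)%N) :
  avg_weight_enum d 0 (codes_of_dim X k) = 1 /\
  (forall i : nat, (1 <= i <= max_weight d)%N ->
     avg_weight_enum d i (codes_of_dim X k)
     = (Q%:R ^+ k - 1) / (Q%:R ^+ N - 1)
       * (weight_enum d i {: finvect_type X})%:R).
Proof.
have weight_eq0 x : (weight d x == 0%N) = (x == 0).
  by case: Xd => -[d0 _ _] _ _ _ _; apply/eqP/eqP => /d0.
have codes_gt0 : (0 < #|codes_of_dim X k|)%N by rewrite card_codes_gt0 ?dimX.
have codes_neq0 : #|codes_of_dim X k|%:R != 0 :> rat.
  by rewrite pnatr_eq0 -lt0n.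
split=> [|i /andP[i_gt0 _]]; rewrite /avg_weight_enum.
  (* Every code contains exactly one vector of weight 0, namely [0], so the average is over ones. *)
  rewrite (eq_bigr (fun=> 1)) ?sumr_const ?mulVf // => C _.
  rewrite /weight_enum (_ : [set x in C | _] = [set 0]) ?cards1 //.
  apply/setP => x; rewrite !inE weight_eq0 andbC.
  by case: eqP => // ->; rewrite mem0v.
have [x x_neq0] : exists x : finvect_type X, x != 0.
  have : {: finvect_type X}%VS != 0%VS.
    by rewrite -dimv_eq0 dimX -lt0n (leq_trans _ N_ge2).
  by rewrite -vpick0; exists (vpick {: finvect_type X}).
have weight0 : ~~ (weight d 0 == i).
  by rewrite (eqP (etrans (weight_eq0 0) (eqxx 0))) eq_sym -lt0n.
have Q_gt1 : (1 < Q)%N by rewrite -cardF finNzRing_gt1.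
have QX_gt0 n : (0 < Q ^ n)%N by rewrite expn_gt0 ltnW.
have QN_neq0 : Q%:R ^+ N - 1 != 0 :> rat.
  rewrite subr_eq0 -natrX (eqr_nat _ _ 1) -(expn0 Q) eqn_exp2l //.
  by rewrite -lt0n (leq_trans _ N_ge2).
have /(congr1 (fun n => n%:R : rat)) := card_codes_mul F X k x x_neq0.
(* Subtraction in [nat] is truncated: [QX_gt0] makes its passage to [rat] legitimate. *)
rewrite dimX cardF !natrM !natrB ?QX_gt0 // !natrX => codes_mul.
rewrite -natr_sum (sum_codes_card F X k _ x) // natrM.
have -> : weight_enum d i {: finvect_type X} = #|[set y | weight d y == i]|.
  by congr #|pred_of_set _|; apply/setP => y; rewrite !inE memvf.
(* Once multiplied by the number of codes, the right-hand side contains the left member of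
   [codes_mul]; replacing it produces the factor that cancels the denominator. *)
apply: (mulfI codes_neq0); rewrite mulVKf //.
by rewrite !mulrA codes_mul [_ * _ / _]mulrAC divff // mul1r mulrC.
Qed.
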